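(* For any simple weight $\mathcal D_n$-module $P$ and any simple weight $\mathfrak{gl}(n)$-module $V$, the $\mathcal W_n$-module $T(P,V)$ has a unique simple submodule.
   Context: Ground field $\mathbb C$. $\mathcal O_n=\mathbb C[x_1,\dots,x_n]$; $\mathcal D_n$ is the Weyl algebra of polynomial differential operators on $\mathcal O_n$; $\mathcal W_n=\mathrm{Der}(\mathcal O_n)$. A weight $\mathcal D_n$-module is one which is the direct sum of its simultaneous eigenspaces for $x_1\partial_1,\dots,x_n\partial_n$; a weight $\mathfrak{gl}(n)$-module is the direct sum of its weight spaces for the diagonal matrices. For a $\mathcal D_n$-module $P$ and a $\mathfrak{gl}(n)$-module $V$, the tensor module $T(P,V)=P\otimes_{\mathbb C}V$ has $\mathcal W_n$-action $x^\alpha\partial_j\cdot(f\otimes v)=(x^\alpha\partial_jf)\otimes v+\sum_{i=1}^n\partial_i(x^\alpha)f\otimes E_{ij}v$. *)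

(* Defs.v *)
From HB Require Import structures.
From mathcomp Require Import all_boot all_order all_algebra.
From mathcomp Require Import boolp classical_sets.
From mathcomp Require Import generic_quotient ring_quotient freeg mpoly.

Set Implicit Arguments.
Unset Strict Implicit.
Unset Printing Implicit Defensive.

Import GRing.Theory.
Local Open Scope ring_scope.
Local Open Scope quotient_scope.

Section Endo.
Variables (K : fieldType) (M : lmodType K).

Record endo := Endo { endo_fun :> M -> M; endo_linear : linear endo_fun }.

HB.instance Definition _ (f : endo) :=
  GRing.isLinear.Build K M M *:%R (endo_fun f) (@endo_linear f).

Lemma endoP (f g : endo) : f =1 g -> f = g.
Proof.
case: f g => [f lf] [g lg] /= /funext fg; rewrite fg in lf *.
by congr Endo; apply: Prop_irrelevance.
Qed.

HB.instance Definition _ := gen_eqMixin endo.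
HB.instance Definition _ := gen_choiceMixin endo.

Fact endo_zero_linear : linear (fun _ : M => 0 : M).
Proof. by move=> a u v; rewrite scaler0 addr0. Qed.
Fact endo_opp_linear (f : endo) : linear (fun x => - f x).
Proof. by move=> a u v; rewrite linearP opprD scalerN. Qed.
Fact endo_add_linear (f g : endo) : linear (fun x => f x + g x).
Proof. by move=> a u v; rewrite !linearP scalerDr addrACA. Qed.
Fact endo_one_linear : linear (fun x : M => x).
Proof. by []. Qed.
Fact endo_mul_linear (f g : endo) : linear (fun x => f (g x)).
Proof. by move=> a u v; rewrite !linearP. Qed.
Fact endo_scale_linear a (f : endo) : linear (fun x => a *: f x).
Proof. by move=> b u v; rewrite linearP scalerDr !scalerA mulrC. Qed.

Let endo_zero := Endo endo_zero_linear.
Let endo_opp f := Endo (endo_opp_linear f).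
Let endo_add f g := Endo (endo_add_linear f g).
Let endo_one := Endo endo_one_linear.
Let endo_mul f g := Endo (endo_mul_linear f g).
Let endo_scale a f := Endo (endo_scale_linear a f).

Fact endo_addA : associative endo_add.
Proof. by move=> f g h; apply: endoP => x /=; rewrite addrA. Qed.
Fact endo_addC : commutative endo_add.
Proof. by move=> f g; apply: endoP => x /=; rewrite addrC. Qed.
Fact endo_add0 : left_id endo_zero endo_add.
Proof. by move=> f; apply: endoP => x /=; rewrite add0r. Qed.
Fact endo_addN : left_inverse endo_zero endo_opp endo_add.
Proof. by move=> f; apply: endoP => x /=; rewrite addNr. Qed.
HB.instance Definition _ :=
  GRing.isZmodule.Build endo endo_addA endo_addC endo_add0 endo_addN.

Fact endo_mulA : associative endo_mul.
Proof. by move=> f g h; apply: endoP. Qed.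
Fact endo_mul1l : left_id endo_one endo_mul.
Proof. by move=> f; apply: endoP. Qed.
Fact endo_mul1r : right_id endo_one endo_mul.
Proof. by move=> f; apply: endoP. Qed.
Fact endo_mulDl : left_distributive endo_mul +%R.
Proof. by move=> f g h; apply: endoP. Qed.
Fact endo_mulDr : right_distributive endo_mul +%R.
Proof. by move=> f g h; apply: endoP => x; rewrite /= raddfD. Qed.
HB.instance Definition _ := GRing.Zmodule_isPzRing.Build endo
  endo_mulA endo_mul1l endo_mul1r endo_mulDl endo_mulDr.

Fact endo_scaleA a b (f : endo) :
  endo_scale a (endo_scale b f) = endo_scale (a * b) f.
Proof. by apply: endoP => x /=; rewrite scalerA. Qed.
Fact endo_scale1 : left_id 1 endo_scale.
Proof. by move=> f; apply: endoP => x /=; rewrite scale1r. Qed.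
Fact endo_scaleDr : right_distributive endo_scale +%R.
Proof. by move=> a f g; apply: endoP => x /=; rewrite scalerDr. Qed.
Fact endo_scaleDl f : {morph endo_scale^~ f : a b / a + b}.
Proof. by move=> a b; apply: endoP => x /=; rewrite scalerDl. Qed.
HB.instance Definition _ := GRing.Zmodule_isLmodule.Build K endo
  endo_scaleA endo_scale1 endo_scaleDr endo_scaleDl.

Lemma endo0E x : (0 : endo) x = 0. Proof. by []. Qed.
Lemma endo1E x : (1 : endo) x = x. Proof. by []. Qed.
Lemma endoDE (f g : endo) x : (f + g) x = f x + g x. Proof. by []. Qed.
Lemma endoNE (f : endo) x : (- f) x = - f x. Proof. by []. Qed.
Lemma endoBE (f g : endo) x : (f - g) x = f x - g x. Proof. by []. Qed.
Lemma endoME (f g : endo) x : (f * g) x = f (g x). Proof. by []. Qed.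
Lemma endoZE a (f : endo) x : (a *: f) x = a *: f x. Proof. by []. Qed.
Lemma endo_sumE I (r : seq I) (Q : pred I) (F : I -> endo) x :
  (\sum_(i <- r | Q i) F i) x = \sum_(i <- r | Q i) F i x.
Proof. exact: (big_morph (fun f : endo => f x)). Qed.
Lemma endo_scaleAl a (f g : endo) : a *: (f * g) = (a *: f) * g.
Proof. by apply: endoP. Qed.
Lemma endo_scaleAr a (f g : endo) : a *: (f * g) = f * (a *: g).
Proof. by apply: endoP => x; rewrite endoZE !endoME endoZE linearZ. Qed.
End Endo.

Section Submodules.
Variables (K : fieldType) (A : Type) (M : lmodType K) (act : A -> endo M).

(* With [act] the structure map of a Weyl-algebra module or of a Lie algebra
   module, these are its submodules; K-linearity is part of the definition. *)
Record submodule (N : set M) : Prop := Submodule {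
  sub0 : N 0;
  sub_linear : forall (a : K) x y, N x -> N y -> N (a *: x + y);
  sub_stable : forall (a : A) x, N x -> N (act a x) }.

(* [simple_submodule N] says that N is a submodule and is simple as a module:
   submodules of N are the submodules of M contained in N. *)
Definition simple_submodule (N : set M) : Prop :=
  [/\ submodule N, N <> [set 0]%classic &
    forall N' : set M, submodule N' -> (N' `<=` N)%classic ->
      N' = [set 0]%classic \/ N' = N].

Definition simple_module : Prop := simple_submodule [set: M]%classic.
End Submodules.

Definition direct_sum (K : fieldType) (M : lmodType K) (I : eqType)
    (F : I -> set M) : Prop :=
  (forall m : M, exists (s : seq I) (u : I -> M),
     [/\ uniq s, forall i, F i (u i) & m = \sum_(i <- s) u i]) /\
  (forall (s : seq I) (u : I -> M), uniq s -> (forall i, F i (u i)) ->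
     \sum_(i <- s) u i = 0 -> {in s, forall i, u i = 0}).

HB.mixin Record Lmodule_isLieAlgebra (K : fieldType) L of GRing.Lmodule K L := {
  lie : L -> L -> L;
  lie_linearl : forall z, linear (lie^~ z);
  lie_linearr : forall z, linear (lie z);
  liexx : forall x, lie x x = 0;
  lie_jacobi :
    forall x y z, lie x (lie y z) + lie y (lie z x) + lie z (lie x y) = 0 }.

#[short(type="lieAlgType")]
HB.structure Definition LieAlgebra (K : fieldType) :=
  {L of Lmodule_isLieAlgebra K L & GRing.Lmodule K L}.

Record lieModule (K : fieldType) (L : lieAlgType K) := LieModule {
  lie_carrier :> lmodType K;
  lie_act : {linear L -> endo lie_carrier};
  lie_actP : forall x y : L,
    lie_act (lie x y) = lie_act x * lie_act y - lie_act y * lie_act x }.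

Section Commutator.
Variable A : pzRingType.
Implicit Types x y z : A.

Definition commutator x y := x * y - y * x.

Lemma commutator_jacobi x y z :
  commutator x (commutator y z) + commutator y (commutator z x)
    + commutator z (commutator x y) = 0.
Proof.
rewrite /commutator !mulrBr !mulrBl !mulrA !opprB.
set a := x * y * z; set b := x * z * y; set c := y * z * x.
set d := z * y * x; set e := y * x * z; set f := z * x * y.
have zmod3 (u v w r s t : A) :
  u - v + (r - s) + (s - w + (v - t)) + (t - r + (w - u)) = 0.
  rewrite (AC ((2*2)*(2*2)*(2*2)) ((1*12)*(2*7)*(3*10)*(4*5)*(6*11)*(8*9)))%AC.
  by rewrite /= !(subrr, addNr, addr0).
exact: zmod3.
Qed.
End Commutator.

Section GeneralLinear.
Variables (K : fieldType) (n : nat).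
Local Notation gl := 'M[K]_n.

Fact gl_linearl (B : gl) : linear (@commutator gl ^~ B).
Proof.
move=> a A A'; rewrite /commutator -!mulmxE mulmxDl mulmxDr.
by rewrite -scalemxAl -scalemxAr scalerBr opprD addrACA.
Qed.
Fact gl_linearr (B : gl) : linear (@commutator gl B).
Proof.
move=> a A A'; rewrite /commutator -!mulmxE mulmxDl mulmxDr.
by rewrite -scalemxAl -scalemxAr scalerBr opprD addrACA.
Qed.

HB.instance Definition _ := Lmodule_isLieAlgebra.Build K gl
  gl_linearl gl_linearr (fun A => subrr (A * A)) (@commutator_jacobi gl).

End GeneralLinear.

Section Differential.
Variables (K : fieldType) (n : nat).
Local Notation O := {mpoly K[n]}.

Fact mulop_linear (f : O) : linear (fun g : O => f * g).
Proof. by move=> a g h; rewrite mulrDr scalerAr. Qed.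
Definition mulop (f : O) : endo O := Endo (mulop_linear f).
Definition derop (i : 'I_n) : endo O := Endo (@mderiv_is_linear n K i).

(* The subalgebra of End_K(O) generated by O and the partial derivatives; in
   characteristic 0 this is the Weyl algebra. *)
Inductive diff_op : endo O -> Prop :=
| diff_op_mul f : diff_op (mulop f)
| diff_op_der i : diff_op (derop i)
| diff_op_lin a d e : diff_op d -> diff_op e -> diff_op (a *: d + e)
| diff_op_comp d e : diff_op d -> diff_op e -> diff_op (d * e).

Definition diff_op_pred : {pred endo O} := fun d => `[< diff_op d >].

Fact diff_op_subring : subring_closed diff_op_pred.
Proof.
split=> [|d e /asboolP dD /asboolP eD|d e /asboolP dD /asboolP eD].
- apply/asboolP; suff -> : 1 = mulop 1 by exact: diff_op_mul.
  by apply: endoP => f /=; rewrite mul1r.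
- by apply/asboolP; rewrite addrC -scaleN1r; apply: diff_op_lin.
- by apply/asboolP; apply: diff_op_comp.
Qed.
HB.instance Definition _ :=
  GRing.isSubringClosed.Build (endo O) diff_op_pred diff_op_subring.

Fact diff_op_scale : GRing.scaler_closed diff_op_pred.
Proof.
move=> a d /asboolP dD; apply/asboolP.
rewrite -[a *: d]addr0; apply: diff_op_lin => //.
by apply: asboolW; apply: (rpred0 diff_op_pred).
Qed.
HB.instance Definition _ :=
  GRing.isScaleClosed.Build K (endo O) diff_op_pred diff_op_scale.

Record weyl := Weyl { weyl_op :> endo O; weyl_opP : weyl_op \in diff_op_pred }.
HB.instance Definition _ := [isSub for weyl_op].
HB.instance Definition _ := [Choice of weyl by <:].
HB.instance Definition _ := GRing.SubChoice_isSubPzRing.Build (endo O) diff_op_pred weyl diff_op_subring.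
HB.instance Definition _ := [SubZmodule_isSubLmodule of weyl by <:].

Definition weyl_mul (f : O) : weyl := Weyl (introT (asboolP _) (diff_op_mul f)).
Definition weyl_der (i : 'I_n) : weyl := Weyl (introT (asboolP _) (diff_op_der i)).

Definition der_pred : {pred endo O} :=
  fun d => `[< forall f g : O, d (f * g) = d f * g + f * d g >].
Fact der_submod : submod_closed der_pred.
Proof.
split=> [|a d e /asboolP dD /asboolP eD]; apply/asboolP=> f g.
  by rewrite !endo0E mul0r mulr0 addr0.
rewrite !endoDE !endoZE dD eD scalerDr mulrDl mulrDr scalerAl scalerAr.
by rewrite addrACA.
Qed.
HB.instance Definition _ :=
  GRing.isSubmodClosed.Build K (endo O) der_pred der_submod.

Record der := Der { der_op :> endo O; der_opP : der_op \in der_pred }.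
HB.instance Definition _ := [isSub for der_op].
HB.instance Definition _ := [Choice of der by <:].
HB.instance Definition _ := [SubChoice_isSubLmodule of der by <:].

Lemma derM (d : der) f g : d (f * g) = d f * g + f * d g.
Proof. by move: (der_opP d) => /asboolP. Qed.

Fact der_lie_subproof (d e : der) : commutator (d : endo O) e \in der_pred.
Proof.
have zmod2 (p q p' q' X Y : O) :
  p + Y + (X + q) + (- (p' + X) - (Y + q')) = p - p' + (q - q').
  rewrite !opprD (AC (2*2*(2*2)) ((1*5)*(4*8)*((2*7)*(3*6))))%AC /=.
  by rewrite !subrr !addr0.
apply/asboolP => f g; rewrite /commutator !endoBE !endoME !derM.
by rewrite !linearD /= !derM mulrBl mulrBr zmod2.
Qed.
Definition der_lie (d e : der) : der := Der (der_lie_subproof d e).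

Lemma der_lieE d e f : der_lie d e f = d (e f) - e (d f).
Proof. by []. Qed.
Lemma der_linE a d e f : (a *: d + e : der) f = a *: d f + e f.
Proof. by []. Qed.

Fact der_lie_linearl e : linear (der_lie^~ e).
Proof.
move=> a d d'; apply: val_inj; apply: endoP => f.
rewrite der_linE !der_lieE !der_linE linearP.
by rewrite scalerBr opprD addrACA.
Qed.
Fact der_lie_linearr e : linear (der_lie e).
Proof.
move=> a d d'; apply: val_inj; apply: endoP => f.
rewrite der_linE !der_lieE !der_linE linearP.
by rewrite scalerBr opprD addrACA.
Qed.
Fact der_liexx d : der_lie d d = 0.
Proof. by apply: val_inj; rewrite /= /commutator subrr. Qed.
Fact der_lie_jacobi d e f :
  der_lie d (der_lie e f) + der_lie e (der_lie f d) + der_lie f (der_lie d e) = 0.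
Proof. by apply: val_inj; apply: commutator_jacobi. Qed.

HB.instance Definition _ := Lmodule_isLieAlgebra.Build K der
  der_lie_linearl der_lie_linearr der_liexx der_lie_jacobi.

End Differential.

Fact linear_fun0 (K : fieldType) (U W : lmodType K) (h : U -> W) :
  linear h -> h 0 = 0.
Proof.
by move=> lh; have := lh (-1) 0 0; rewrite scaler0 addr0 scaleN1r addNr.
Qed.
Fact linear_funD (K : fieldType) (U W : lmodType K) (h : U -> W) x y :
  linear h -> h (x + y) = h x + h y.
Proof. by move=> lh; have := lh 1 x y; rewrite !scale1r. Qed.
Fact linear_funZ (K : fieldType) (U W : lmodType K) (h : U -> W) a x :
  linear h -> h (a *: x) = a *: h x.
Proof. by move=> lh; have := lh a x 0; rewrite (linear_fun0 lh) !addr0. Qed.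

Section Tensor.
Variables (K : fieldType) (P V : lmodType K).
Local Notation free := {freeg (P * V) / K}.

Inductive tensor_rel : free -> Prop :=
| tensor_rel_addl p p' v :
    tensor_rel (<< (p + p', v) >> - << (p, v) >> - << (p', v) >>)
| tensor_rel_addr p v v' :
    tensor_rel (<< (p, v + v') >> - << (p, v) >> - << (p, v') >>)
| tensor_rel_scalel a p v :
    tensor_rel (<< (a *: p, v) >> - a *: << (p, v) >>)
| tensor_rel_scaler a p v :
    tensor_rel (<< (p, a *: v) >> - a *: << (p, v) >>)
| tensor_rel0 : tensor_rel 0
| tensor_rel_lin a x y :
    tensor_rel x -> tensor_rel y -> tensor_rel (a *: x + y).

Definition tensor_pred : {pred free} := fun x => `[< tensor_rel x >].
Fact tensor_pred_submod : submod_closed tensor_pred.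
Proof.
split=> [|a x y /asboolP xR /asboolP yR]; apply/asboolP.
  exact: tensor_rel0.
exact: tensor_rel_lin.
Qed.
HB.instance Definition _ :=
  GRing.isSubmodClosed.Build K free tensor_pred tensor_pred_submod.

Definition tensor := Quotient.quot tensor_pred.
HB.instance Definition _ := GRing.Zmodule.on tensor.
HB.instance Definition _ := EqQuotient.on tensor.

Definition tensor_scale (a : K) (t : tensor) : tensor := \pi_tensor (a *: repr t).
Fact pi_tensor_scale a x : tensor_scale a (\pi_tensor x) = \pi_tensor (a *: x).
Proof.
apply/eqP; rewrite -Quotient.idealrBE -scalerBr rpredZ //.
by rewrite Quotient.idealrBE reprK.
Qed.
Lemma pi_tensorD x y : \pi_tensor (x + y) = \pi_tensor x + \pi_tensor y.
Proof. exact: (Quotient.pi_add tensor_pred x y). Qed.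

Fact tensor_scaleA a b t : tensor_scale a (tensor_scale b t) = tensor_scale (a * b) t.
Proof. by rewrite -[t]reprK (pi_tensor_scale b) !pi_tensor_scale scalerA. Qed.
Fact tensor_scale1 : left_id 1 tensor_scale.
Proof. by move=> t; rewrite -[t]reprK pi_tensor_scale scale1r. Qed.
Fact tensor_scaleDr : right_distributive tensor_scale +%R.
Proof.
move=> a t u; rewrite -[t]reprK -[u]reprK -pi_tensorD !pi_tensor_scale.
by rewrite -pi_tensorD scalerDr.
Qed.
Fact tensor_scaleDl t : {morph tensor_scale^~ t : a b / a + b}.
Proof.
by move=> a b; rewrite -[t]reprK !pi_tensor_scale scalerDl pi_tensorD.
Qed.
HB.instance Definition _ := GRing.Zmodule_isLmodule.Build K tensor
  tensor_scaleA tensor_scale1 tensor_scaleDr tensor_scaleDl.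

Fact pi_tensor_linear : linear \pi_tensor.
Proof. by move=> a x y; rewrite pi_tensorD -pi_tensor_scale. Qed.

Definition pure (p : P) (v : V) : tensor := \pi_tensor << (p, v) >>.

Lemma pi_tensor0 x : tensor_rel x -> \pi_tensor x = 0.
Proof.
move=> xR; have -> : 0 = \pi_tensor 0.
  by apply: (addrI (\pi_tensor 0)); rewrite addr0 -pi_tensorD addr0.
by apply/eqP; rewrite -Quotient.idealrBE subr0; apply: asboolT.
Qed.

Fact pi_tensor_eq x y : tensor_rel (x - y) -> \pi_tensor x = \pi_tensor y.
Proof.
by move=> xyR; apply/eqP; rewrite -Quotient.idealrBE; apply: asboolT.
Qed.

Fact pure_linearl v : linear (pure^~ v).
Proof.
move=> a p p'; rewrite [a *: pure p v]pi_tensor_scale.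
rewrite -(pi_tensor_eq (tensor_rel_scalel a p v)) -pi_tensorD.
by apply: pi_tensor_eq; rewrite opprD addrA; apply: tensor_rel_addl.
Qed.
Fact pure_linearr p : linear (pure p).
Proof.
move=> a v v'; rewrite [a *: pure p v]pi_tensor_scale.
rewrite -(pi_tensor_eq (tensor_rel_scaler a p v)) -pi_tensorD.
by apply: pi_tensor_eq; rewrite opprD addrA; apply: tensor_rel_addr.
Qed.

Lemma tensor_ind (Q : tensor -> Prop) :
  (forall p v, Q (pure p v)) ->
  (forall a t u, Q t -> Q u -> Q (a *: t + u)) -> Q 0 -> forall t, Q t.
Proof.
move=> Qpure Qlin Q0 t; rewrite -[t]reprK -(freeg_sumE (repr t)).
elim: (dom _) => [|[p v] s IH].
  by rewrite big_nil pi_tensor0 //; apply: tensor_rel0.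
rewrite big_cons pi_tensorD.
have -> : << coeff (p, v) (repr t) *g (p, v) >>
    = coeff (p, v) (repr t) *: << (p, v) >> :> free.
  by apply/eqP/freeg_eqP => k; rewrite coeffZ !coeffU mul1r.
rewrite -[\pi_tensor (_ *: _)]pi_tensor_scale.
by apply: (Qlin _ (pure p v)) => //; apply: Qpure.
Qed.

Lemma tensor_ext (W : lmodType K) (f g : tensor -> W) :
  linear f -> linear g -> (forall p v, f (pure p v) = g (pure p v)) -> f =1 g.
Proof.
move=> lf lg fg; apply: tensor_ind => // [a t u tE uE|].
  by rewrite lf lg tE uE.
by rewrite !linear_fun0.
Qed.

Section Lift.
Variables (W : lmodType K) (b : P -> V -> W).
Hypotheses (b_linearl : forall v, linear (b^~ v)) (b_linearr : forall p, linear (b p)).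

Let free_lift : free -> W := fglift (fun x => b x.1 x.2).
Definition tensor_lift (t : tensor) : W := free_lift (repr t).

Let free_liftB x y : free_lift (x - y) = free_lift x - free_lift y.
Proof. exact: lift_is_additive. Qed.
Let free_lift0 : free_lift 0 = 0.
Proof. by rewrite -(subrr 0) free_liftB subrr. Qed.
Let free_liftD x y : free_lift (x + y) = free_lift x + free_lift y.
Proof.
by rewrite -[y in LHS]opprK free_liftB -[- y]sub0r free_liftB free_lift0 sub0r opprK.
Qed.
Let free_lift_sum I (r : seq I) (F : I -> free) :
  free_lift (\sum_(i <- r) F i) = \sum_(i <- r) free_lift (F i).
Proof. exact: (big_morph free_lift). Qed.
Let free_liftU p v : free_lift << (p, v) >> = b p v.
Proof. by rewrite /free_lift liftU scale1r. Qed.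
Let free_liftZ a x : free_lift (a *: x) = a *: free_lift x.
Proof.
rewrite -{2}(freeg_sumE x) [a *: x]/(fgscale a x) /fgscale !free_lift_sum.
rewrite scaler_sumr; apply: eq_bigr => k _.
by rewrite /free_lift !liftU scalerA.
Qed.
Let free_lift_rel x : tensor_rel x -> free_lift x = 0.
Proof.
elim=> {x} [p p' v|p v v'|a p v|a p v||a x y _ x0 _ y0].
- rewrite !free_liftB !free_liftU (linear_funD _ _ (b_linearl v)).
  by rewrite addrAC addrK subrr.
- rewrite !free_liftB !free_liftU (linear_funD _ _ (b_linearr p)).
  by rewrite addrAC addrK subrr.
- by rewrite free_liftB free_liftZ !free_liftU (linear_funZ _ _ (b_linearl v)) subrr.
- by rewrite free_liftB free_liftZ !free_liftU (linear_funZ _ _ (b_linearr p)) subrr.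
- exact: free_lift0.
- by rewrite free_liftD free_liftZ x0 y0 scaler0 addr0.
Qed.
Let pi_lift x : tensor_lift (\pi_tensor x) = free_lift x.
Proof.
apply/eqP; rewrite -subr_eq0 /tensor_lift -free_liftB; apply/eqP.
apply: free_lift_rel; apply: asboolW.
by rewrite -[X in is_true X]/(_ \in tensor_pred) Quotient.idealrBE reprK.
Qed.

Lemma tensor_lift_pure p v : tensor_lift (pure p v) = b p v.
Proof. by rewrite pi_lift free_liftU. Qed.

Fact tensor_lift_linear : linear tensor_lift.
Proof.
move=> a t u; rewrite -[t]reprK -[u]reprK [a *: _]pi_tensor_scale -pi_tensorD.
by rewrite !pi_lift free_liftD free_liftZ.
Qed.
End Lift.
End Tensor.

Section TensorEndo.
Variables (K : fieldType) (P V : lmodType K).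
Implicit Types (a : endo P) (b : endo V).

Fact tensor_op_linearl a b v : linear (fun p => pure (a p) (b v)).
Proof. by move=> c p p'; rewrite linearP pure_linearl. Qed.
Fact tensor_op_linearr a b p : linear (fun v => pure (a p) (b v)).
Proof. by move=> c v v'; rewrite linearP pure_linearr. Qed.

Definition tensor_op a b : endo (tensor P V) :=
  Endo (tensor_lift_linear (tensor_op_linearl a b) (tensor_op_linearr a b)).

Lemma tensor_opE a b p v : tensor_op a b (pure p v) = pure (a p) (b v).
Proof.
exact: (tensor_lift_pure (tensor_op_linearl a b) (tensor_op_linearr a b)).
Qed.

Lemma endo_tensorP (f g : endo (tensor P V)) :
  (forall p v, f (pure p v) = g (pure p v)) -> f = g.
Proof. by move=> fg; apply: endoP; apply: tensor_ext => //; apply: endo_linear. Qed.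

Lemma tensor_opM a b a' b' :
  tensor_op a b * tensor_op a' b' = tensor_op (a * a') (b * b').
Proof. by apply: endo_tensorP => p v; rewrite endoME !tensor_opE. Qed.
Fact tensor_op_linear_l b : linear (tensor_op^~ b).
Proof.
move=> c a a'; apply: endo_tensorP => p v.
by rewrite endoDE endoZE !tensor_opE -pure_linearl.
Qed.
Fact tensor_op_linear_r a : linear (tensor_op a).
Proof.
move=> c b b'; apply: endo_tensorP => p v.
by rewrite endoDE endoZE !tensor_opE -pure_linearr.
Qed.
Lemma tensor_opBl a a' b : tensor_op (a - a') b = tensor_op a b - tensor_op a' b.
Proof. by rewrite addrC -scaleN1r tensor_op_linear_l scaleN1r addrC. Qed.
HB.instance Definition _ a := GRing.isLinear.Build K (endo V)
  (endo (tensor P V)) *:%R (tensor_op a) (tensor_op_linear_r a).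
End TensorEndo.

Section Derivations.
Variables (K : fieldType) (n : nat).
Local Notation O := {mpoly K[n]}.

Lemma der1 (d : der K n) : d 1 = 0.
Proof.
have := derM d 1 1; rewrite mulr1 mul1r mulr1 => /eqP.
by rewrite -subr_eq0 opprD addNKr oppr_eq0 => /eqP.
Qed.

Lemma der_sum (d : der K n) (f : O) : d f = \sum_(j < n) d 'X_j * f^`M(j).
Proof.
pose e (g : O) := d g - \sum_(j < n) d 'X_j * g^`M(j).
have eM (g h : O) : e (g * h) = e g * h + g * e h.
  have -> : e (g * h) = d g * h + g * d h
    - (\sum_j (d 'X_j * g^`M(j)) * h + \sum_j g * (d 'X_j * h^`M(j))).
    rewrite /e derM -big_split; congr (_ - _); apply: eq_bigr => j _.
    by rewrite mderivM mulrDr /= !mulrA [_ * g]mulrC.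
  by rewrite -mulr_suml -mulr_sumr opprD addrACA -mulrBl -mulrBr.
have e1 : e 1 = 0.
  rewrite /e der1 big1 ?subr0 // => j _.
  by rewrite -mpolyC1 mderivC mulr0.
have eX k : e 'X_k = 0.
  rewrite /e (bigD1 k) //= big1 => [|j jk].
    by rewrite mderivX mnm1E eqxx scale1r -[X in (X - _)%MM]add0m addmK mpolyX0 mulr1 addr0 subrr.
  by rewrite mderivX mnm1E eq_sym (negbTE jk) scale0r mulr0.
have eXm m : e 'X_[m] = 0.
  rewrite mpolyXE_id; elim/big_ind: _ => // [g h eg eh|k _].
    by rewrite eM eg eh mul0r mulr0 addr0.
  elim: (m k) => [|q IH]; first by rewrite expr0.
  by rewrite exprS eM eX IH mul0r mulr0 addr0.
have elin : linear e.
  move=> a g h; rewrite /e linearP scalerBr addrACA -opprD; congr (_ - _).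
  rewrite scaler_sumr -big_split; apply: eq_bigr => j _.
  by rewrite linearP mulrDr scalerAr.
apply/eqP; rewrite -subr_eq0 -/(e f); apply/eqP.
pose el : endo O := Endo elin.
rewrite -[e f]/(el f) [f]mpolyE linear_sum big1 // => m _ /=.
by rewrite -[e _]/(el _) linearZ /= eXm scaler0.
Qed.
End Derivations.

(* [weyl_actZ] says that the K-structure of the carrier is the one induced by
   the scalars of the Weyl algebra. *)
Record weylModule (K : fieldType) (n : nat) := WeylModule {
  weyl_carrier :> lmodType K;
  weyl_act : {rmorphism weyl K n -> endo weyl_carrier};
  weyl_actZ : scalable weyl_act }.

Section TensorModule.
Variables (K : fieldType) (n : nat).
Local Notation O := {mpoly K[n]}.
Local Notation W := (der K n).
Variables (P : weylModule K n) (V : lieModule 'M[K]_n).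

Implicit Types A B C D : 'M[O]_n.

(* The inclusion of Der(O) in the Weyl algebra; see [weyl_of_derE]. *)
Definition weyl_of_der (w : W) : weyl K n :=
  \sum_(j < n) weyl_mul (w 'X_j) * weyl_der K j.

Lemma weyl_opD (a b : weyl K n) : weyl_op (a + b) = weyl_op a + weyl_op b.
Proof. by []. Qed.
Lemma weyl_opM (a b : weyl K n) : weyl_op (a * b) = weyl_op a * weyl_op b.
Proof. by []. Qed.

Lemma weyl_of_derE (w : W) : weyl_op (weyl_of_der w) = w.
Proof.
apply: endoP => f; rewrite der_sum.
by rewrite (big_morph (@weyl_op K n) weyl_opD (erefl _)) endo_sumE.
Qed.

Fact weyl_of_der_linear : linear weyl_of_der.
Proof.
by move=> a w u; apply: val_inj; rewrite /= !weyl_of_derE.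
Qed.

Lemma weyl_of_der_lie (w u : W) :
  weyl_of_der (lie w u) = weyl_of_der w * weyl_of_der u - weyl_of_der u * weyl_of_der w.
Proof. by apply: val_inj; rewrite /= !weyl_of_derE. Qed.

Lemma weyl_mul_linear : linear (@weyl_mul K n).
Proof.
move=> a f g; apply: val_inj; apply: endoP => h.
by rewrite /= mulrDl scalerAl.
Qed.
Lemma weyl_mulM (f g : O) : weyl_mul (f * g) = weyl_mul f * weyl_mul g.
Proof. by apply: val_inj; apply: endoP => h /=; rewrite mulrA. Qed.
Lemma weyl_mul_der (w : W) (f : O) :
  weyl_mul (w f) = weyl_of_der w * weyl_mul f - weyl_mul f * weyl_of_der w.
Proof.
apply: val_inj; apply: endoP => h.
rewrite -[RHS]/(weyl_op (weyl_of_der w) (f * h) - f * weyl_op (weyl_of_der w) h).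
by rewrite !weyl_of_derE derM addrK.
Qed.

Definition jacobian (w : W) : 'M[O]_n := \matrix_(i, j) (w 'X_j)^`M(i).

Definition mx_op (A : 'M[O]_n) : endo (tensor P V) :=
  \sum_(i < n) \sum_(j < n)
    tensor_op (weyl_act P (weyl_mul (A i j))) (lie_act V (delta_mx i j)).

(* For w = \sum_j g_j d/dx_j, with g_j = w(x_j):
     w (f (x) v) = (w f) (x) v + \sum_(i, j) (d g_j/dx_i f) (x) E_ij v,
   the linear extension of the action of the x^m d/dx_j, which is computed in
   [tensor_module_monomial] below. *)
Definition tensor_act_fun (w : W) : endo (tensor P V) :=
  tensor_op (weyl_act P (weyl_of_der w)) 1 + mx_op (jacobian w).

Fact mx_op_lin a A B : mx_op (map_mx ( *:%R a) A + B) = a *: mx_op A + mx_op B.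
Proof.
rewrite /mx_op scaler_sumr -big_split; apply: eq_bigr => i _ /=.
rewrite scaler_sumr -big_split; apply: eq_bigr => j _ /=.
by rewrite !mxE weyl_mul_linear rmorphD /= weyl_actZ tensor_op_linear_l.
Qed.

Lemma mx_opD A B : mx_op (A + B) = mx_op A + mx_op B.
Proof.
have {1}-> : A = map_mx ( *:%R 1) A by apply/matrixP => i j; rewrite mxE scale1r.
by rewrite mx_op_lin scale1r.
Qed.
Lemma mx_opB A B : mx_op (A - B) = mx_op A - mx_op B.
Proof. by apply: (addIr (mx_op B)); rewrite -mx_opD !subrK. Qed.

Fact jacobian_lin a w u :
  jacobian (a *: w + u) = map_mx ( *:%R a) (jacobian w) + jacobian u.
Proof. by apply/matrixP => i j; rewrite !mxE der_linE linearP. Qed.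

Fact tensor_act_linear : linear tensor_act_fun.
Proof.
move=> a w u; rewrite /tensor_act_fun jacobian_lin mx_op_lin weyl_of_der_linear.
by rewrite rmorphD /= weyl_actZ tensor_op_linear_l scalerDr addrACA.
Qed.
HB.instance Definition _ := GRing.isLinear.Build K W (endo (tensor P V)) *:%R
  tensor_act_fun tensor_act_linear.

Fact mx_op_mul A B :
  \sum_(p : 'I_n * 'I_n) \sum_(q : 'I_n * 'I_n)
     tensor_op (weyl_act P (weyl_mul (A p.1 p.2 * B q.1 q.2)))
       (lie_act V (delta_mx p.1 p.2 *m delta_mx q.1 q.2))
  = mx_op (A *m B).
Proof.
pose F i j k l := tensor_op (weyl_act P (weyl_mul (A i j * B k l)))
  (lie_act V (delta_mx i j *m delta_mx k l)).
transitivity (\sum_i \sum_j \sum_k \sum_l F i j k l).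
  rewrite [RHS]pair_bigA; apply: eq_bigr => p _.
  by rewrite [RHS]pair_bigA.
apply: eq_bigr => i _.
transitivity (\sum_j \sum_l F i j j l).
  apply: eq_bigr => j _; rewrite (bigD1 j) //= [X in _ + X]big1 ?addr0 // => k kj.
  apply: big1 => l _.
  by rewrite /F mul_delta_mx_cond eq_sym (negbTE kj) mulr0n !raddf0.
rewrite exchange_big; apply: eq_bigr => l _ /=.
rewrite mxE.
have mD f g : weyl_mul (f + g : O) = weyl_mul f + weyl_mul g.
  exact: linear_funD (weyl_mul_linear).
rewrite (big_morph _ mD (linear_fun0 weyl_mul_linear)) raddf_sum.
rewrite (big_morph (fun a => tensor_op a (lie_act V (delta_mx i l)))
  (fun a b => linear_funD a b (tensor_op_linear_l _))
  (linear_fun0 (tensor_op_linear_l _))).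
by apply: eq_bigr => j _; rewrite /F mul_delta_mx.
Qed.

Fact mx_op_comm A B :
  mx_op A * mx_op B - mx_op B * mx_op A = mx_op (commutator A B).
Proof.
have mx_opE C : mx_op C = \sum_(p : 'I_n * 'I_n)
    tensor_op (weyl_act P (weyl_mul (C p.1 p.2))) (lie_act V (delta_mx p.1 p.2)).
  by rewrite /mx_op pair_bigA.
have mul_opE C D : mx_op C * mx_op D = \sum_(p : 'I_n * 'I_n) \sum_(q : 'I_n * 'I_n)
    tensor_op (weyl_act P (weyl_mul (C p.1 p.2 * D q.1 q.2)))
      (lie_act V (delta_mx p.1 p.2) * lie_act V (delta_mx q.1 q.2)).
  rewrite !mx_opE mulr_suml; apply: eq_bigr => p _.
  rewrite mulr_sumr; apply: eq_bigr => q _.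
  by rewrite tensor_opM -rmorphM -weyl_mulM.
rewrite !mul_opE [X in _ - X]exchange_big -sumrB.
have -> : mx_op (commutator A B) = mx_op (A *m B) - mx_op (B *m A).
  exact: mx_opB.
rewrite -!mx_op_mul [X in _ = _ - X]exchange_big -sumrB; apply: eq_bigr => p _.
rewrite -!sumrB; apply: eq_bigr => q _ /=.
rewrite [B _ _ * _]mulrC -!raddfB; congr (tensor_op _ _).
by rewrite -lie_actP.
Qed.

Fact mx_op_der w A :
  tensor_op (weyl_act P (weyl_of_der w)) 1 * mx_op A
    - mx_op A * tensor_op (weyl_act P (weyl_of_der w)) 1
  = mx_op (map_mx w A).
Proof.
rewrite /mx_op mulr_sumr mulr_suml -sumrB; apply: eq_bigr => i _.
rewrite mulr_sumr mulr_suml -sumrB; apply: eq_bigr => j _.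
rewrite !tensor_opM mul1r mulr1 mxE weyl_mul_der rmorphB !rmorphM /=.
by rewrite tensor_opBl.
Qed.

Fact jacobian_lie w u :
  jacobian (lie w u) = map_mx w (jacobian u) - map_mx u (jacobian w)
    + commutator (jacobian w) (jacobian u).
Proof.
have jacM (d e : W) i j :
  (d (e 'X_j))^`M(i) = d ((e 'X_j)^`M(i)) + (jacobian d *m jacobian e) i j.
  rewrite (der_sum d (e 'X_j)) (der_sum d ((e 'X_j)^`M(i))) mxE raddf_sum -big_split; apply: eq_bigr => k _ /=.
  by rewrite !mxE mderivM addrC mderiv_comm.
apply/matrixP => i j; rewrite [LHS]mxE -[lie w u]/(der_lie w u) der_lieE.
rewrite raddfB /= !jacM /commutator -!mulmxE opprD addrACA.
set X := jacobian w *m _; set Y := jacobian u *m _.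
by rewrite !mxE.
Qed.

Fact tensor_act_lie w u :
  tensor_act_fun (lie w u) =
    tensor_act_fun w * tensor_act_fun u - tensor_act_fun u * tensor_act_fun w.
Proof.
have zmod6 (a b c d a' b' c' d' : endo (tensor P V)) :
    a + b + (c + d) - (a' + c' + (b' + d'))
    = a - a' + (b - b' - (c' - c) + (d - d')).
  rewrite !opprD opprK (AC (2*2*(2*2)) ((1*5)*((2*7)*(6*3)*(4*8))))%AC /=.
  by [].
rewrite /tensor_act_fun !mulrDl !mulrDr zmod6 !mx_op_der mx_op_comm.
rewrite weyl_of_der_lie rmorphB !rmorphM /= tensor_opBl !tensor_opM !mul1r.
congr (_ + _); rewrite jacobian_lie mx_opD mx_opB.
by [].
Qed.

Definition tensor_module : lieModule W :=
  @LieModule K W (tensor P V) tensor_act_fun tensor_act_lie.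

End TensorModule.

Section MonomialFormula.
Variables (K : fieldType) (n : nat).
Local Notation O := {mpoly K[n]}.

Fact monomial_der_subproof (m : 'X_{1..n}) (j : 'I_n) :
  (mulop 'X_[m] * derop K j : endo O) \in @der_pred K n.
Proof.
apply/asboolP => f g; rewrite !endoME /= mderivM mulrDr !mulrA.
by rewrite ['X_[m] * f]mulrC.
Qed.

Definition monomial_der m j : der K n := Der (monomial_der_subproof m j).

Lemma tensor_module_monomial (P : weylModule K n) (V : lieModule 'M[K]_n)
    (m : 'X_{1..n}) (j : 'I_n) (f : P) (v : V) :
  lie_act (tensor_module P V) (monomial_der m j) (pure f v) =
    pure (weyl_act P (weyl_mul 'X_[m] * weyl_der K j) f) v
    + \sum_(i < n) pure (weyl_act P (weyl_mul 'X_[m]^`M(i)) f)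
                        (lie_act V (delta_mx i j) v).
Proof.
have wX k : monomial_der m j 'X_k = 'X_[m] *+ (k == j).
  rewrite /= mderivX mnm1E; case: eqVneq => [->|_].
    by rewrite scale1r -[X in (X - _)%MM]add0m addmK mpolyX0 mulr1.
  by rewrite scale0r mulr0.
have wE : weyl_of_der (monomial_der m j) = weyl_mul 'X_[m] * weyl_der K j.
  by apply: val_inj; rewrite /= weyl_of_derE.
rewrite [lie_act _ _]/(tensor_act_fun P V _) /tensor_act_fun endoDE tensor_opE wE.
congr (_ + _); rewrite endo_sumE; apply: eq_bigr => i _.
rewrite endo_sumE (bigD1 j) // big1 => [|k kj].
  by rewrite tensor_opE mxE wX eqxx mulr1n; apply: addr0.
rewrite tensor_opE mxE wX (negbTE kj) mulr0n raddf0.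
rewrite (linear_fun0 (@weyl_mul_linear K n)) raddf0.
exact: linear_fun0 (pure_linearl _).
Qed.
End MonomialFormula.

Section WeightModules.
Variables (K : fieldType) (n : nat).

Definition weyl_weight_space (P : weylModule K n) (l : 'rV[K]_n) : set P :=
  [set p | forall i : 'I_n,
     weyl_act P (weyl_mul 'X_i * weyl_der K i) p = l 0 i *: p]%classic.

Definition weyl_weight_module (P : weylModule K n) : Prop :=
  direct_sum (@weyl_weight_space P).

(* The weight l is the functional diag(d_1, ..., d_n) |-> \sum_i l_i d_i *)
Definition gl_weight_space (V : lieModule 'M[K]_n) (l : 'rV[K]_n) : set V :=
  [set v | forall d : 'rV[K]_n,
     lie_act V (diag_mx d) v = (\sum_(i < n) l 0 i * d 0 i) *: v]%classic.

Definition gl_weight_module (V : lieModule 'M[K]_n) : Prop :=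
  direct_sum (@gl_weight_space V).
End WeightModules.

(* Main.v *)
(* Every nonzero submodule N of T(P, V) contains all the vectors
     diff_tensor w p v = \sum_i d_i p (x) E_iw v.
   Indeed N is stable under [theta D w] = D d_w (x) 1 + \sum_i [d_i, D] (x) E_iw for
   every D in the Weyl algebra: for D = f this is the action of the vector field
   f d_w, and [theta (D d_j) w] is [theta D w] composed with d_j. Weight spaces of
   P are lines separated by polynomials in the x_i d_i, so that D can be chosen
   to isolate the component p_l (x) v_l of an element of N for a maximal weight l,
   which gives diff_tensor w p v_l in N for all p and w. The v with this property
   form a gl(n)-submodule, hence are all of V.
   If some diff_tensor w p v is nonzero, the submodule which it generates is thus
   the least nonzero submodule. Otherwise gl(n) acts by 0 on V, which is a line, and
   a nonzero submodule either is everything or is killed by all the d_i; the vectors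
   of P killed by the d_i have weight 0 and form at most a line. *)

Require Import Defs.
From mathcomp Require Import all_boot all_algebra.
From mathcomp Require Import boolp classical_sets reals complex.
From mathcomp Require Import mpoly.

Set Implicit Arguments.
Unset Strict Implicit.
Unset Printing Implicit Defensive.

Import GRing.Theory Num.Theory.
Local Open Scope ring_scope.

(** * Submodules, and a criterion for a unique simple one *)

Section Socle.
Variables (K : fieldType) (A : Type) (M : lmodType K) (act : A -> endo M).

Lemma submoduleD N x y : submodule act N -> N x -> N y -> N (x + y).
Proof. by move=> sN Nx Ny; rewrite -[x]scale1r; apply: (sub_linear sN). Qed.

Lemma submoduleZ N a x : submodule act N -> N x -> N (a *: x).
Proof.
by move=> sN Nx; rewrite -[_ *: _]addr0; apply: (sub_linear sN) => //; apply: (sub0 sN).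
Qed.

Lemma submoduleB N x y : submodule act N -> N x -> N y -> N (x - y).
Proof. by move=> sN Nx Ny; apply: submoduleD => //; rewrite -scaleN1r; apply: submoduleZ. Qed.

Lemma submodule_neq0 N x : submodule act N -> N x -> x != 0 -> N <> [set 0]%classic.
Proof. by move=> sN Nx x0 NE; move: Nx; rewrite NE => /eqP; rewrite (negbTE x0). Qed.

Lemma submodule_has_neq0 N : submodule act N -> N <> [set 0]%classic ->
  exists2 x, N x & x != 0.
Proof.
move=> sN N0; apply: contrapT => H; apply: N0; apply/seteqP; split=> x /=.
  by move=> Nx; apply/eqP; apply: contrapT => /negP x0; apply: H; exists x.
by move=> ->; apply: (sub0 sN).
Qed.

Lemma simple_module_full N x : simple_module act -> submodule act N ->
  N x -> x != 0 -> forall y, N y.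
Proof.
move=> [_ _ simM] sN Nx x0 y; have [//|NE|->//] := simM N sN.
by case: (submodule_neq0 sN Nx x0).
Qed.

Lemma simple_module_neq0 : simple_module act -> exists x : M, x != 0.
Proof. by move=> [sT T0 _]; have [x _ x0] := submodule_has_neq0 sT T0; exists x. Qed.

Lemma unique_simple_submodule x0 : x0 != 0 ->
  (forall N x, submodule act N -> N x -> x != 0 -> N x0) ->
  exists! N, simple_submodule act N.
Proof.
move=> x0_neq0 Nx0.
have inN N : submodule act N -> N <> [set 0]%classic -> N x0.
  by move=> sN /(submodule_has_neq0 sN)[x Nx xn0]; apply: Nx0 Nx xn0.
pose N0 : set M := fun x => forall N, submodule act N -> N x0 -> N x.
have sN0 : submodule act N0.
  split=> [N sN _|a x y N0x N0y N sN Nx|a x N0x N sN Nx]; first exact: (sub0 sN).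
    by apply: (sub_linear sN); [apply: N0x | apply: N0y].
  by apply: (sub_stable sN); apply: N0x.
have N0_neq0 : N0 <> [set 0]%classic by apply: (@submodule_neq0 _ x0).
exists N0; split=> [|N [sN N_neq0 simN]].
  split=> // N sN NN0.
  have [->|/(inN _ sN) N'x0] := pselect (N = [set 0]%classic); [by left | right].
  by apply/seteqP; split=> // x N0x; apply: N0x.
have N0N : (N0 `<=` N)%classic by move=> x; apply=> //; apply: inN.
by case: (simN N0 sN0 N0N).
Qed.
End Socle.

(** * Normal ordering in the Weyl algebra and the Euler operators *)

Section WeylAlgebra.
Variables (K : fieldType) (n : nat).
Local Notation O := {mpoly K[n]}.
Local Notation D := (weyl K n).
Local Notation dx := (weyl_der K).

Lemma weyl_der_mul j (f : O) :
  dx j * weyl_mul f = weyl_mul f * dx j + weyl_mul f^`M(j).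
Proof.
by apply: val_inj; apply: endoP => h; rewrite /= mderivM addrC.
Qed.

Lemma weyl_derC (i j : 'I_n) : dx i * dx j = dx j * dx i.
Proof. by apply: val_inj; apply: endoP => h; rewrite /= mderiv_comm. Qed.

Lemma weyl_mul1 : weyl_mul 1 = 1 :> D.
Proof. by apply: val_inj; apply: endoP => h; rewrite /= mul1r. Qed.

(* The operators \sum_k f_k d^(a_k), with all the derivatives on the right. *)
Inductive normal_op : D -> Prop :=
| normal_op_mul f : normal_op (weyl_mul f)
| normal_op_lin a d e : normal_op d -> normal_op e -> normal_op (a *: d + e)
| normal_op_der d j : normal_op d -> normal_op (d * dx j).

Lemma weyl_scalerAr a (d e : D) : d * (a *: e) = a *: (d * e).
Proof. by apply: val_inj; rewrite /= endo_scaleAr. Qed.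
Lemma weyl_scalerAl a (d e : D) : (a *: d) * e = a *: (d * e).
Proof. by apply: val_inj; apply: endoP. Qed.

Lemma normal_op_mulr d f : normal_op d -> normal_op (d * weyl_mul f).
Proof.
move=> dN; elim: dN f => {d} [g|a d e _ IHd _ IHe|d j _ IHd] f.
- by rewrite -weyl_mulM; apply: normal_op_mul.
- by rewrite mulrDl weyl_scalerAl; apply: normal_op_lin.
rewrite -mulrA weyl_der_mul mulrDr mulrA -[_ * dx j]scale1r.
by apply: normal_op_lin => //; apply: normal_op_der.
Qed.

Lemma weyl_normal_op (d : D) : normal_op d.
Proof.
(* A normal left factor [s] is carried along, so that a composition is absorbed one factor at a time
   on the right. *)
have mulN e : diff_op e -> forall s t, normal_op s -> weyl_op t = e -> normal_op (s * t).
  elim=> {e} [f|j|a d1 d2 d1D IH1 d2D IH2|d1 d2 d1D IH1 d2D IH2] s t sN tE.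
  - by rewrite (_ : t = weyl_mul f); [apply: normal_op_mulr | apply: val_inj].
  - by rewrite (_ : t = dx j); [apply: normal_op_der | apply: val_inj].
  - rewrite (_ : t = a *: Weyl (asboolT d1D) + Weyl (asboolT d2D)); last exact: val_inj.
    by rewrite mulrDr weyl_scalerAr; apply: normal_op_lin; [apply: IH1 | apply: IH2].
  rewrite (_ : t = Weyl (asboolT d1D) * Weyl (asboolT d2D)); last exact: val_inj.
  by rewrite mulrA; apply: IH2 => //; apply: IH1.
rewrite -[d]mul1r -weyl_mul1; apply: (mulN (weyl_op d)) => //.
  exact: asboolW (weyl_opP d).
exact: normal_op_mul.
Qed.

Definition euler (i : 'I_n) : D := weyl_mul 'X_i * dx i.

Lemma euler_mulX i (m : 'X_{1..n}) :
  euler i * weyl_mul 'X_[m] = weyl_mul 'X_[m] * euler i + (m i)%:R *: weyl_mul 'X_[m].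
Proof.
apply: val_inj; apply: endoP => h /=.
rewrite mderivM mulrDr addrC; congr (_ + _).
  by rewrite !mulrA ['X_i * _]mulrC.
(* The exponent of the derivative is a truncated difference: for [m i = 0] it is meaningless, but
   its coefficient is zero. *)
rewrite mderivX; case: (posnP (m i)) => [->|mi]; first by rewrite !scale0r mul0r mulr0.
rewrite -scalerAl -scalerAr mulrA -mpolyXD addmC submK //.
by apply/mnm_lepP => j; rewrite mnm1E; case: eqP => // <-.
Qed.

Lemma euler_der i j : euler i * dx j = dx j * euler i - (i == j)%:R *: dx j.
Proof.
rewrite /euler mulrA weyl_der_mul mulrDl -!mulrA (weyl_derC i j) mderivX mnm1E.
case: eqVneq => [->|_].
  by rewrite -[X in (X - _)%MM]add0m addmK mpolyX0 scale1r weyl_mul1 mul1r scale1r addrK.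
by rewrite !scale0r subr0 (linear_fun0 (@weyl_mul_linear K n)) mul0r addr0.
Qed.
End WeylAlgebra.

(** * Weight vectors of a simple Weyl module: multiplicity one and density *)

Section WeightVectors.
Variables (K : numFieldType) (n : nat) (P : weylModule K n).
Local Notation D := (weyl K n).
Local Notation dx := (weyl_der K).
Local Notation act := (weyl_act P).
Local Notation wt := (@weyl_weight_space K n P).

Lemma weyl_actM d e p : act (d * e) p = act d (act e p).
Proof. by rewrite rmorphM. Qed.
Lemma weyl_actD d e p : act (d + e) p = act d p + act e p.
Proof. by rewrite rmorphD. Qed.
Lemma weyl_actB d e p : act (d - e) p = act d p - act e p.
Proof. by rewrite rmorphB. Qed.
Lemma weyl_actZE a d p : act (a *: d) p = a *: act d p.
Proof. by rewrite weyl_actZ. Qed.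
Lemma weyl_act1 p : act 1 p = p.
Proof. by rewrite rmorph1. Qed.

Lemma act_euler l p i : wt l p -> act (euler K i) p = l 0 i *: p.
Proof. exact. Qed.

Lemma wt0 l : wt l 0.
Proof. by move=> i; rewrite linear0 scaler0. Qed.

Lemma wt_mulX l (m : 'X_{1..n}) p : wt l p ->
  wt (l + \row_i (m i)%:R) (act (weyl_mul 'X_[m]) p).
Proof.
move=> pl i; rewrite -/(euler K i) -weyl_actM euler_mulX weyl_actD weyl_actM weyl_actZE.
by rewrite (act_euler _ pl) linearZ /= -scalerDl !mxE.
Qed.

Lemma wt_der l j p : wt l p -> wt (l - delta_mx 0 j) (act (dx j) p).
Proof.
move=> pl i; rewrite -/(euler K i) -weyl_actM euler_der weyl_actB weyl_actM weyl_actZE.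
by rewrite (act_euler _ pl) linearZ /= -scalerBl !mxE eqxx.
Qed.

(** Interpolation in the Euler operators: [e] is the product over m in [F] of (x_i d_i - m_i)/(l_i -
    m_i), where i is a coordinate in which l and m differ. *)
Lemma weight_separation l (F : seq 'rV[K]_n) : l \notin F ->
  exists2 e : D, forall p, wt l p -> act e p = p &
    forall m p, m \in F -> wt m p -> act e p = 0.
Proof.
elim: F => [_|m F IH]; first by exists 1 => // p _; rewrite weyl_act1.
rewrite inE negb_or => /andP[lm /IH[e el eF]].
have [i lmi] : exists i, l 0 i != m 0 i.
  apply: contrapT => H; move/eqP: lm; apply; apply/rowP => i.
  by apply/eqP; apply: contrapT => /negP ?; apply: H; exists i.
exists (e * ((l 0 i - m 0 i)^-1 *: (euler K i - m 0 i *: (1 : D)))) => [p pl|m' p].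
  rewrite weyl_actM weyl_actZE weyl_actB weyl_actZE weyl_act1 (act_euler _ pl) -scalerBl scalerA.
  by rewrite mulVf ?subr_eq0 // scale1r el.
rewrite inE weyl_actM weyl_actZE weyl_actB weyl_actZE weyl_act1.
move=> /predU1P[-> pm|m'F pm'].
  by rewrite (act_euler _ pm) -scalerBl subrr scale0r scaler0 linear0.
by rewrite (act_euler _ pm') -scalerBl scalerA linearZ /= (eF m') // scaler0.
Qed.

Hypothesis simP : simple_module act.

Lemma weyl_cyclic p q : p != 0 -> exists d, act d p = q.
Proof.
move=> p0; apply: (simple_module_full (N := fun q => exists d, act d p = q) simP _ _ p0).
  split=> [|a _ _ [d <-] [e <-]|a _ [d <-]].
  - by exists 0; rewrite rmorph0.
  - by exists (a *: d + e); rewrite weyl_actD weyl_actZE.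
  - by exists (a * d); rewrite weyl_actM.
by exists 1; rewrite weyl_act1.
Qed.

Definition ders (s : seq 'I_n) : D := \prod_(j <- s) dx j.

Lemma wt_ders l s p : wt l p -> wt (l - \row_i (count_mem i s)%:R) (act (ders s) p).
Proof.
move=> pl; elim: s => [|j s IH].
  by rewrite /ders big_nil weyl_act1 (_ : l - _ = l) //; apply/rowP => i; rewrite !mxE subr0.
rewrite /ders big_cons weyl_actM; have := wt_der j IH.
congr wt; apply/rowP => i; rewrite !mxE eqxx /= natrD opprD addrA addrAC.
by rewrite eq_sym.
Qed.

(** The operator x^a d^a is a product of falling factorials of the x_i d_i, which act on [p] by
    scalars. *)
Lemma mulX_ders_scalar l s p : wt l p ->
  exists c, act (weyl_mul 'X_[[multinom count_mem i s | i < n]] * ders s) p = c *: p.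
Proof.
move=> pl; elim: s => [|j s [c IH]].
  exists 1; have -> : [multinom count_mem i ([::] : seq 'I_n) | i < n] = 0%MM.
    by apply/mnmP => i; rewrite mnm0E.
  by rewrite mpolyX0 weyl_mul1 /ders big_nil mul1r weyl_act1 scale1r.
have -> : [multinom count_mem i (j :: s) | i < n] = ([multinom count_mem i s | i < n] + U_(j))%MM.
  by apply/mnmP => i; rewrite mnmDE !mnmE /= addnC.
have := wt_ders s pl; set q := act (ders s) p => ql.
(* The new factor x_j d_j meets [ders s] applied to [p], whose weight is l lowered by the
   multiplicities in [s]. *)
exists ((l - \row_i (count_mem i s)%:R) 0 j * c).
rewrite mpolyXD weyl_mulM /ders big_cons -!mulrA [weyl_mul 'X_j * _]mulrA.
rewrite !weyl_actM -(weyl_actM (weyl_mul 'X_j)) (act_euler _ ql) linearZ /=.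
by rewrite -weyl_actM -scalerA -IH weyl_actM.
Qed.

(* [wt_coef l p q c]: the weight-l component of q, computed by any Weyl element
   which projects onto weight l along finitely many other weights, is c p. *)
Definition wt_coef l (p q : P) c := exists2 F : seq 'rV[K]_n, l \notin F &
  forall e, (forall r, wt l r -> act e r = r) ->
    (forall m r, m \in F -> wt m r -> act e r = 0) -> act e q = c *: p.

Lemma wt_coef_linear l p a q q' c c' : wt_coef l p q c -> wt_coef l p q' c' ->
  wt_coef l p (a *: q + q') (a * c + c').
Proof.
move=> [F lF Fq] [F' lF' Fq']; exists (F ++ F').
  by rewrite mem_cat negb_or lF.
move=> e el eF; rewrite linearP /= Fq ?Fq' //; first by rewrite scalerDl scalerA.
- by move=> m r mF; apply: eF; rewrite mem_cat mF orbT.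
- by move=> m r mF; apply: eF; rewrite mem_cat mF.
Qed.

Lemma wt_coef_other l m p q : l != m -> wt m q -> wt_coef l p q 0.
Proof.
move=> lm qm; exists [:: m]; first by rewrite inE.
by move=> e _ em; rewrite (em m) ?inE // scale0r.
Qed.

Lemma wt_coef_self l p c : wt l p -> wt_coef l p (c *: p) c.
Proof. by move=> pl; exists [::] => // e el _; rewrite linearZ /= el. Qed.

Lemma wt_coef_unique l p q c c' : p != 0 -> wt_coef l p q c -> wt_coef l p q c' -> c = c'.
Proof.
move=> p0 [F lF Fq] [F' lF' Fq'].
have [|e el eF] := @weight_separation l (F ++ F'); first by rewrite mem_cat negb_or lF.
apply/eqP; rewrite -subr_eq0; have /eqP : (c - c') *: p = 0.
  rewrite scalerBl -(Fq e) ?(Fq' e) ?subrr // => m r mF.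
    by apply: eF; rewrite mem_cat mF orbT.
  by apply: eF; rewrite mem_cat mF.
by rewrite scaler_eq0 (negbTE p0) orbF.
Qed.

(** By simplicity q = d p, and d can be put in normal form. A term x^m d^a p has weight l + m - a,
    which in characteristic 0 differs from l unless m = a, and then the term is a multiple of p. *)
Lemma wt_coef_exists l p q : wt l p -> p != 0 -> exists c, wt_coef l p q c.
Proof.
move=> pl p0; have [d <-] := weyl_cyclic q p0.
(* The factor [ders s] collects the derivatives that the induction strips from the right of [d]. *)
suff : forall s, exists c, wt_coef l p (act (d * ders s) p) c.
  by move=> /(_ [::]); rewrite /ders big_nil mulr1.
elim: (weyl_normal_op d) => {d} [f|a d e _ IHd _ IHe|d j _ IHd] s.
- elim/mpolyind: f => [|a m f _ _ [c IH]].
    exists 0; rewrite (linear_fun0 (@weyl_mul_linear K n)) mul0r rmorph0 endo0E.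
    by rewrite -(scale0r p); apply: wt_coef_self.
  rewrite weyl_mul_linear mulrDl weyl_actD weyl_scalerAl weyl_actZE.
  suff [c' c'P] : exists c', wt_coef l p (act (weyl_mul 'X_[m] * ders s) p) c'.
    by exists (a * c' + c); apply: wt_coef_linear.
  have [->|ms] := eqVneq m [multinom count_mem i s | i < n].
    by have [c' ->] := mulX_ders_scalar s pl; exists c'; apply: wt_coef_self.
  exists 0; rewrite weyl_actM; apply: wt_coef_other (wt_mulX m (wt_ders s pl)).
  apply: contra_neq ms => /rowP lE; apply/mnmP => i; have := lE i.
  rewrite !mxE mnmE -addrA -[LHS]addr0 => /addrI /esym /eqP.
  by rewrite addrC subr_eq0 eqr_nat => /eqP.
- have [c cP] := IHd s; have [c' c'P] := IHe s; exists (a * c + c').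
  by rewrite mulrDl weyl_scalerAl weyl_actD weyl_actZE; apply: wt_coef_linear.
- by have := IHd (j :: s); rewrite /ders big_cons mulrA.
Qed.

Lemma wt_space_line l p q : wt l p -> p != 0 -> wt l q -> exists c, q = c *: p.
Proof.
move=> pl p0 ql; have [c [F lF Fq]] := wt_coef_exists q pl p0; exists c.
by have [e el eF] := weight_separation lF; rewrite -(Fq e) // el.
Qed.

(** The functional chooses for each vector its weight-l coefficient along [p]; uniqueness of the
    coefficient makes the choice linear. *)
Lemma wt_functional l p : wt l p -> p != 0 ->
  exists2 phi : P -> K, (forall a q q', phi (a *: q + q') = a * phi q + phi q') & phi p = 1.
Proof.
move=> pl p0.
have /choice[phi phiP] := fun q => wt_coef_exists q pl p0.
exists phi => [a q q'|].
  exact: wt_coef_unique p0 (phiP _) (wt_coef_linear _ (phiP _) (phiP _)).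
by apply: wt_coef_unique p0 (phiP _) _; rewrite -[X in wt_coef _ _ X]scale1r; apply: wt_coef_self.
Qed.

(** A density statement for weight vectors: first separate l from the weights in [F], then move [p]
    to [q] by simplicity. *)
Lemma weyl_density l (F : seq 'rV[K]_n) p q : wt l p -> p != 0 -> l \notin F ->
  exists2 d : D, act d p = q & forall m r, m \in F -> wt m r -> act d r = 0.
Proof.
move=> pl p0 lF; have [e el eF] := weight_separation lF; have [d dq] := weyl_cyclic q p0.
exists (d * e); first by rewrite weyl_actM el.
by move=> m r mF rm; rewrite weyl_actM (eF m) // linear0.
Qed.

Lemma wt_basis : exists2 b : 'rV[K]_n -> P, (forall l, wt l (b l)) &
  forall l q, wt l q -> exists c, q = c *: b l.
Proof.
have /choice[b bP] : forall l, exists b, wt l b /\ forall q, wt l q -> exists c, q = c *: b.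
  move=> l; have [[p [pl p0]]|H] := pselect (exists p, wt l p /\ p != 0).
    by exists p; split=> // q; apply: wt_space_line.
  (* When l is not a weight of P, the chosen spanning vector is 0. *)
  exists 0; split; first exact: wt0.
  move=> q ql; exists 0; rewrite scaler0; apply/eqP; apply: contrapT => /negP q0.
  by apply: H; exists q.
by exists b => [l|l q]; have [bl] := bP l => //; apply.
Qed.

(** Otherwise one could add unit vectors forever inside [F], and the coordinate sums along this
    chain, increasing by 1 each time, would be infinitely many distinct values in characteristic
    0. *)
Lemma maximal_weight (F : seq 'rV[K]_n) : F != [::] ->
  exists2 l, l \in F & forall i, l + delta_mx 0 i \notin F.
Proof.
case: F => // l0 F _; set G := l0 :: F; apply: contrapT => H.
pose tot (l : 'rV[K]_n) := \sum_i l 0 i.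
have chain k : exists2 l, l \in G & tot l = tot l0 + k%:R.
  elim: k => [|k [l lG lE]]; first by exists l0; rewrite ?mem_head ?addr0.
  have [i lG'] : exists i, l + delta_mx 0 i \in G.
    apply: contrapT => H'; apply: H; exists l => // i; apply/negP => lG'.
    by apply: H'; exists i.
  exists (l + delta_mx 0 i) => //.
  rewrite /tot (eq_bigr (fun j => l 0 j + (j == i)%:R)) => [|j _]; last first.
    by rewrite !mxE eqxx.
  rewrite big_split /= -/(tot l) lE -addrA -natr1; congr (_ + (_ + _)).
  by rewrite (bigD1 i) //= eqxx big1 ?addr0 // => j /negbTE ->.
pose s := [seq tot l0 + k%:R | k <- iota 0 (size G).+1].
have s_uniq : uniq s.
  by rewrite map_inj_uniq ?iota_uniq // => k k' /addrI /eqP; rewrite eqr_nat => /eqP.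
have : (size s <= size (map tot G))%N.
  apply: uniq_leq_size => // _ /mapP[k _ ->].
  by have [l lG <-] := chain k; apply: map_f.
by rewrite !size_map size_iota ltnn.
Qed.

End WeightVectors.

(** * Bilinearity of pure tensors *)

Section Pure.
Variables (K : fieldType) (P V : lmodType K).

Lemma pure0l v : pure (0 : P) v = 0 :> tensor P V.
Proof. exact: linear_fun0 (pure_linearl v). Qed.
Lemma pure0r p : pure p (0 : V) = 0 :> tensor P V.
Proof. exact: linear_fun0 (pure_linearr p). Qed.
Lemma pureDl p q v : pure (p + q) v = pure p v + pure q v :> tensor P V.
Proof. exact: linear_funD (pure_linearl v). Qed.
Lemma pureDr p v w : pure p (v + w) = pure p v + pure p w :> tensor P V.
Proof. exact: linear_funD (pure_linearr p). Qed.
Lemma pureZl a p v : pure (a *: p) v = a *: pure p v :> tensor P V.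
Proof. exact: linear_funZ (pure_linearl v). Qed.
Lemma pureZr a p v : pure p (a *: v) = a *: pure p v :> tensor P V.
Proof. exact: linear_funZ (pure_linearr p). Qed.
Lemma pureBl p q v : pure (p - q) v = pure p v - pure q v :> tensor P V.
Proof. by rewrite pureDl -scaleN1r pureZl scaleN1r. Qed.
End Pure.

(** * Operators on T(P, V) that preserve every submodule *)

Section SubmodulesOfTensor.
Variables (K : fieldType) (n : nat).
Variables (P : weylModule K n) (V : lieModule 'M[K]_n).
Local Notation O := {mpoly K[n]}.
Local Notation D := (weyl K n).
Local Notation dx := (weyl_der K).
Local Notation act := (weyl_act P).
Local Notation T := (tensor_module P V).
Local Notation E i j := (lie_act V (delta_mx i j)).

Fact poly_der_subproof (f : O) (j : 'I_n) :
  (mulop f * derop K j : endo O) \in @der_pred K n.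
Proof.
apply/asboolP => g h; rewrite !endoME /= mderivM mulrDr !mulrA.
by rewrite [f * g]mulrC.
Qed.
Definition poly_der f j : der K n := Der (poly_der_subproof f j).

Lemma tensor_act_poly_der f w : lie_act T (poly_der f w) =
  tensor_op (act (weyl_mul f * dx w)) 1
    + \sum_i tensor_op (act (weyl_mul f^`M(i))) (E i w) :> endo (tensor P V).
Proof.
have wX k : poly_der f w 'X_k = f *+ (k == w).
  rewrite /= mderivX mnm1E; case: eqVneq => [->|_].
    by rewrite scale1r -[X in (X - _)%MM]add0m addmK mpolyX0 mulr1.
  by rewrite scale0r mulr0.
rewrite [LHS]/(tensor_act_fun P V _) /tensor_act_fun; congr (_ + _).
  by congr (tensor_op (act _) _); apply: val_inj; rewrite /= weyl_of_derE.
apply: eq_bigr => i _; rewrite (bigD1 w) //= big1 ?addr0 => [|k kw].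
  by rewrite mxE wX eqxx.
rewrite mxE wX (negbTE kw) mulr0n mderiv0 (linear_fun0 (@weyl_mul_linear K n)) rmorph0.
exact: linear_fun0 (tensor_op_linear_l _).
Qed.

(* For d = f this is the action of the vector field f d/dx_w. *)
Definition theta (d : D) w : endo (tensor P V) :=
  tensor_op (act (d * dx w)) 1
    + \sum_i tensor_op (act (dx i * d - d * dx i)) (E i w).

Lemma theta_pure d w p v : theta d w (pure p v) = pure (act d (act (dx w) p)) v
  + \sum_i pure (act (dx i) (act d p) - act d (act (dx i) p)) (E i w v).
Proof.
rewrite /theta endoDE tensor_opE endo_sumE rmorphM; congr (_ + _).
by apply: eq_bigr => i _; rewrite tensor_opE rmorphB !rmorphM.
Qed.

Lemma theta_linear w : linear (theta^~ w).
Proof.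
move=> a d e; rewrite /theta mulrDl weyl_scalerAl rmorphD /= weyl_actZ.
rewrite tensor_op_linear_l scalerDr addrACA; congr (_ + _).
rewrite scaler_sumr -big_split; apply: eq_bigr => i _ /=.
rewrite -tensor_op_linear_l -weyl_actZ -rmorphD /=; congr (tensor_op (act _) _).
rewrite mulrDr mulrDl weyl_scalerAl weyl_scalerAr opprD addrACA scalerBr.
by [].
Qed.

Lemma theta_mul f w : theta (weyl_mul f) w = lie_act T (poly_der f w).
Proof.
rewrite tensor_act_poly_der; congr (_ + _); apply: eq_bigr => i _.
by rewrite weyl_der_mul addrAC subrr add0r.
Qed.

(** Partial derivatives commute, so [d_i, d d_j] = [d_i, d] d_j, and d_j factors out of every term
    on the right. *)
Lemma theta_der d j w : theta (d * dx j) w = theta d w * tensor_op (act (dx j)) 1.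
Proof.
rewrite /theta mulrDl tensor_opM -rmorphM mulr1 -!mulrA (weyl_derC K j w).
congr (_ + _); rewrite mulr_suml; apply: eq_bigr => i _.
by rewrite tensor_opM mulr1 -rmorphM mulrBl -!mulrA (weyl_derC K j i).
Qed.

(** The constant vector field d_j has zero Jacobian, hence acts on the factor P only. *)
Lemma submodule_der N j t : submodule (lie_act T) N -> N t ->
  N (tensor_op (act (dx j)) 1 t).
Proof.
move=> sN /(sub_stable sN (poly_der 1 j)); rewrite tensor_act_poly_der weyl_mul1 mul1r.
rewrite big1 ?addr0 // => i _; rewrite -mpolyC1 mderivC.
rewrite (linear_fun0 (@weyl_mul_linear K n)) rmorph0.
exact: linear_fun0 (tensor_op_linear_l _).
Qed.

Lemma submodule_theta N d w t : submodule (lie_act T) N -> N t -> N (theta d w t).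
Proof.
move=> sN; elim: (weyl_normal_op d) t => {d} [f|a d e _ IHd _ IHe|d j _ IHd] t Nt.
- by rewrite theta_mul; apply: (sub_stable sN).
- rewrite theta_linear; apply: (sub_linear sN); [exact: IHd | exact: IHe].
- by rewrite theta_der; apply: IHd; apply: submodule_der.
Qed.

(** The linear vector fields x_a d_b span a copy of gl(n), which acts on T(P, V) as on a tensor
    product of two gl(n)-modules. *)
Lemma tensor_act_gl a b p v : lie_act T (poly_der 'X_a b) (pure p v) =
  pure (act (weyl_mul 'X_a * dx b) p) v + pure p (E a b v) :> tensor P V.
Proof.
rewrite tensor_act_poly_der endoDE tensor_opE; congr (_ + _).
rewrite endo_sumE (bigD1 a) // big1 => [|i ia].
  rewrite tensor_opE mderivX mnm1E eqxx scale1r -[X in (X - _)%MM]add0m addmK mpolyX0.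
  by rewrite weyl_mul1 rmorph1; apply: addr0.
rewrite tensor_opE mderivX mnm1E eq_sym (negbTE ia) scale0r.
by rewrite (linear_fun0 (@weyl_mul_linear K n)) rmorph0 pure0l.
Qed.

(* When V is an exterior power of K^n, E_iw is the contraction by e_w followed by
   the product with e_i, and this is the de Rham differential of the contraction
   of p (x) v by e_w. *)
Definition diff_tensor w p v : tensor P V := \sum_i pure (act (dx i) p) (E i w v).

Lemma diff_tensor_linear w p : linear (diff_tensor w p).
Proof.
move=> a u v; rewrite /diff_tensor scaler_sumr -big_split; apply: eq_bigr => i _ /=.
by rewrite linearP pure_linearr.
Qed.

Lemma gl_delta_comm a b i w v : E a b (E i w v) =
  E i w (E a b v) + (b == i)%:R *: E a w v - (w == a)%:R *: E i b v.
Proof.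
have := @lie_actP _ _ V (delta_mx a b) (delta_mx i w).
move/(congr1 (fun f : endo V => f v)); rewrite endoBE !endoME => /eqP.
rewrite eq_sym subr_eq => /eqP ->; rewrite addrC -addrA; congr (_ + _).
rewrite /lie /= /commutator.
rewrite -[delta_mx a b * _]/(delta_mx a b *m delta_mx i w).
rewrite -[delta_mx i w * _]/(delta_mx i w *m delta_mx a b).
rewrite !mul_delta_mx_cond linearB /= !linearMn /= !scaler_nat.
by case: (b == i); case: (w == a).
Qed.

(** Equivariance under the linear vector fields: the index i is contracted between d_i and E_iw, so
    only [p], [v] and the free index [w] are transformed. *)
Lemma diff_tensor_gl a b w p v : lie_act T (poly_der 'X_a b) (diff_tensor w p v) =
  diff_tensor w (act (weyl_mul 'X_a * dx b) p) v + diff_tensor w p (E a b v)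
    - (w == a)%:R *: diff_tensor b p v.
Proof.
rewrite /diff_tensor linear_sum /= scaler_sumr -big_split -sumrB /=.
have -> : \sum_i lie_act T (poly_der 'X_a b) (pure (act (dx i) p) (E i w v)) =
   \sum_i (pure (act (dx i) (act (weyl_mul 'X_a * dx b) p)) (E i w v)
     + pure (act (dx i) p) (E i w (E a b v)) - (w == a)%:R *: pure (act (dx i) p) (E i b v)
     + ((b == i)%:R *: pure (act (dx i) p) (E a w v) 
       - (i == a)%:R *: pure (act (dx b) p) (E i w v))) :> tensor P V.
  apply: eq_bigr => i _; rewrite tensor_act_gl gl_delta_comm.
  have -> : act (weyl_mul 'X_a * dx b) (act (dx i) p) =
      act (dx i) (act (weyl_mul 'X_a * dx b) p) - (i == a)%:R *: act (dx b) p.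
    rewrite -!endoME -!rmorphM /= mulrA weyl_der_mul mulrDl -!mulrA (weyl_derC K b i).
    rewrite rmorphD /= mderivX mnm1E eq_sym.
    case: eqVneq => [->|_].
      rewrite !scale1r -[X in (X - _)%MM]add0m addmK mpolyX0 weyl_mul1 mul1r.
      by rewrite addrK.
    by rewrite !scale0r (linear_fun0 (@weyl_mul_linear K n)) mul0r rmorph0 endo0E addr0 subr0.
  rewrite pureBl pureZl !pureDr -[- (_ *: E i b v)]scaleN1r !pureZr scaleN1r.
  by rewrite (AC (2*3) ((1*3*5)*(4*2)))%AC.
rewrite big_split /= [X in _ + X](_ : _ = 0) ?addr0 //.
(* The leftover sums reduce to their terms i = b and i = a; both are d_b p (x) E_aw v and cancel. *)
rewrite sumrB (bigD1 b) //= eqxx scale1r big1 ?addr0 => [|i ib]; last first.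
  by rewrite eq_sym (negbTE ib) scale0r.
rewrite (bigD1 a) //= eqxx scale1r big1 ?addr0 ?subrr // => i ia.
by rewrite (negbTE ia) scale0r.
Qed.

Lemma gl_simple_module_full (S : set V) v0 : simple_module (lie_act V) ->
  S 0 -> (forall a u v, S u -> S v -> S (a *: u + v)) ->
  (forall a b v, S v -> S (E a b v)) -> S v0 -> v0 != 0 -> forall v, S v.
Proof.
move=> simV S0 Slin SE Sv0 v0_neq0; apply: (simple_module_full simV _ Sv0 v0_neq0).
split=> // A v Sv; have SD u u' : S u -> S u' -> S (u + u').
  by move=> Su Su'; rewrite -[u]scale1r; apply: Slin.
rewrite [A]matrix_sum_delta linear_sum /= endo_sumE.
apply: big_ind => // i _; rewrite linear_sum /= endo_sumE.
apply: big_ind => // j _; rewrite linearZ /= -[_ *: _]addr0.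
by apply: Slin => //; apply: SE.
Qed.

Lemma submodule_diff_tensor N v0 : simple_module (lie_act V) ->
  submodule (lie_act T) N -> v0 != 0 -> (forall w p, N (diff_tensor w p v0)) ->
  forall w p v, N (diff_tensor w p v).
Proof.
move=> simV sN v0_neq0 Nv0 w p v; move: v w p.
pose S v := forall w p, N (diff_tensor w p v).
apply: (gl_simple_module_full (S := S) simV _ _ _ Nv0) => //.
- by move=> w p; rewrite (linear_fun0 (diff_tensor_linear w p)); apply: (sub0 sN).
- by move=> a u v Nu Nv w p; rewrite diff_tensor_linear; apply: (sub_linear sN).
move=> a b v Nv w p.
(* This is [diff_tensor_gl] solved for the term in E_ab v. The remaining terms change [p] and [w],
   which is why [S] quantifies over both. *)
have -> : diff_tensor w p (E a b v) = lie_act T (poly_der 'X_a b) (diff_tensor w p v)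
    - diff_tensor w (act (weyl_mul 'X_a * dx b) p) v + (w == a)%:R *: diff_tensor b p v.
  by rewrite diff_tensor_gl addrAC subrK addrAC subrr add0r.
apply: (submoduleD sN); last by apply: (submoduleZ _ sN); apply: Nv.
by apply: (submoduleB sN); [apply: (sub_stable sN); apply: Nv | apply: Nv].
Qed.
End SubmodulesOfTensor.

(** * The least nonzero submodule of T(P, V) *)

Section TensorSocle.
Variables (K : numFieldType) (n : nat).
Variables (P : weylModule K n) (V : lieModule 'M[K]_n).
Local Notation dx := (weyl_der K).
Local Notation act := (weyl_act P).
Local Notation T := (tensor_module P V).
Local Notation E i j := (lie_act V (delta_mx i j)).
Local Notation wt := (@weyl_weight_space K n P).
Hypotheses (simP : simple_module act) (wtP : weyl_weight_module P).
Hypothesis simV : simple_module (lie_act V).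

Lemma weight_span (f : endo P) : (forall l p, wt l p -> f p = 0) -> forall p, f p = 0.
Proof.
move=> f0 p; have [s [u [_ us ->]]] := wtP.1 p.
by rewrite linear_sum big1 // => l _; apply: (f0 l).
Qed.

(** If d_i killed all weight vectors it would kill P, and so would [d_i, x_i] = 1. *)
Lemma der_neq0 i : exists l p, wt l p /\ act (dx i) p != 0.
Proof.
apply: contrapT => H; have [p /eqP[]] := simple_module_neq0 simP.
have dx0 q : act (dx i) q = 0.
  apply: weight_span => l r rl; apply/eqP; apply: contrapT => /negP r0.
  by apply: H; exists l, r.
have := dx0 (act (weyl_mul 'X_i) p).
rewrite -weyl_actM weyl_der_mul weyl_actD weyl_actM dx0 linear0 add0r.
rewrite mderivX mnm1E eqxx scale1r -[X in (X - _)%MM]add0m addmK mpolyX0.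
by rewrite weyl_mul1 weyl_act1.
Qed.

Lemma weight_vector_exists : exists l p, wt l p /\ p != 0.
Proof.
apply: contrapT => H; have [p /eqP[]] := simple_module_neq0 simP.
apply: (weight_span (f := 1)) => l q ql; apply/eqP; apply: contrapT => /negP q0.
by apply: H; exists l, q.
Qed.

(** Contracting the first factor with the coordinate functional of [p] sends [pure p v] to [v]. *)
Lemma pure_neq0 l p (v : V) : wt l p -> p != 0 -> v != 0 -> pure p v != 0.
Proof.
move=> pl p0; apply: contra_neq => pv0; have [phi philin phi1] := wt_functional simP pl p0.
have ll (u : V) : linear (fun q => phi q *: u).
  by move=> a q q'; rewrite philin scalerDl scalerA.
have lr (q : P) : linear (fun u : V => phi q *: u).
  by move=> a u u'; rewrite scalerDr !scalerA mulrC.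
have := tensor_lift_pure ll lr p v; rewrite pv0 phi1 scale1r => <-.
exact: linear_fun0 (tensor_lift_linear ll lr).
Qed.

Section Basis.
Variable b : 'rV[K]_n -> P.
Hypotheses (b_wt : forall l, wt l (b l)) (b_span : forall l q, wt l q -> exists c, q = c *: b l).

Lemma tensor_weight_decomposition t : exists2 F : seq 'rV[K]_n, uniq F &
  exists2 v : 'rV[K]_n -> V, (forall l, l \notin F -> v l = 0) &
    t = \sum_(l <- F) pure (b l) (v l) :> tensor P V.
Proof.
(* Since [v] vanishes off its list, the list can be enlarged; two decompositions are then added over
   a common one. *)
have extend (F G : seq 'rV[K]_n) (v : 'rV[K]_n -> V) : uniq F -> uniq G -> {subset F <= G} ->
    (forall l, l \notin F -> v l = 0) ->
    \sum_(l <- F) pure (b l) (v l) = \sum_(l <- G) pure (b l) (v l).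
  move=> Fu Gu FG v0; rewrite [RHS](bigID (mem F)) /= [X in _ + X]big1 ?addr0.
    rewrite -[RHS]big_filter; apply: perm_big; apply: uniq_perm => //.
      exact: filter_uniq.
    by move=> l; rewrite mem_filter; case: (boolP (l \in F)) => // /FG ->.
  by move=> l lF; rewrite v0 // pure0r.
move: t; apply: tensor_ind => [p v|a t t' [F Fu [v v0 ->]] [G Gu [w w0 ->]]|].
- have [s [u [su us ->]]] := wtP.1 p.
  have /choice[c cP] := fun l => b_span (us l).
  exists s => //; exists (fun l => if l \in s then c l *: v else 0).
    by move=> l /negbTE ->.
  rewrite (big_morph (fun q => pure q v) (fun p q => pureDl p q v) (pure0l _ v)).
  by apply: eq_big_seq => l ls; rewrite ls {1}cP pureZl pureZr.
- pose H := undup (F ++ G).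
  have memH l : l \in H = (l \in F) || (l \in G) by rewrite mem_undup mem_cat.
  exists H; first exact: undup_uniq.
  exists (fun l => a *: v l + w l).
    by move=> l; rewrite memH negb_or => /andP[/v0 -> /w0 ->]; rewrite scaler0 addr0.
  rewrite (extend F H) ?(extend G H) ?undup_uniq //.
  - by rewrite scaler_sumr -big_split; apply: eq_bigr => l _; rewrite /= pure_linearr.
  - by move=> l lG; rewrite memH lG orbT.
  - by move=> l lF; rewrite memH lF.
by exists [::] => //; exists (fun=> 0) => //; rewrite big_nil.
Qed.

(* Let l be a weight of t such that no l + e_i is one. Choosing d in [theta d w t]
   to kill b m for all other weights m of t and for all m - e_i, only the terms
   dx i * d of theta survive, and only on the component of weight l. *)
Lemma submodule_has_diff_tensor N t : submodule (lie_act T) N -> N t -> t != 0 ->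
  exists2 v, v != 0 & forall w p, N (diff_tensor w p v).
Proof.
move=> sN Nt t0; have [F Fu [v _ tE]] := tensor_weight_decomposition t.
(* Zero terms are discarded first, so that the maximal weight carries a nonzero component. *)
pose F0 := [seq l <- F | pure (b l) (v l) != 0].
have tE0 : t = \sum_(l <- F0) pure (b l) (v l).
  rewrite tE big_filter [LHS](bigID (fun l => pure (b l) (v l) != 0)) /=.
  by rewrite [X in _ + X]big1 ?addr0 // => l /negPn/eqP.
have F0_neq0 : F0 != [::].
  by apply: contra_neq t0 => F00; rewrite tE0 F00 big_nil.
have [l lF0 lmax] := maximal_weight F0_neq0.
have bl_neq0 : pure (b l) (v l) != 0 by move: lF0; rewrite mem_filter => /andP[].
exists (v l); first by apply: contra_neq bl_neq0 => ->; rewrite pure0r.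
move=> w p.
have bl0 : b l != 0 by apply: contra_neq bl_neq0 => ->; rewrite pure0l.
pose G := rem l F0 ++ [seq m - delta_mx 0 i | m <- F0, i <- enum 'I_n].
have F0u : uniq F0 by apply: filter_uniq.
have lG : l \notin G.
  rewrite mem_cat negb_or mem_rem_uniqF //=; apply/allpairsP => -[[m i] /= [mF0 _ lE]].
  by have := lmax i; rewrite lE subrK mF0.
have [d dp dG] := weyl_density simP p (b_wt l) bl0 lG.
have db i m : m \in F0 -> act d (act (dx i) (b m)) = 0.
  move=> mF0; apply: (dG (m - delta_mx 0 i)); last exact: wt_der.
  rewrite mem_cat; apply/orP; right; apply/allpairsP; exists (m, i).
  by rewrite mem_enum.
have := submodule_theta d w sN Nt; congr N.
have -> : theta P V d w t = \sum_(m <- F0) theta P V d w (pure (b m) (v m)).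
  by rewrite tE0; apply: linear_sum.
rewrite (bigD1_seq l) // big1_seq => [|m /andP[ml mF0]].
  rewrite theta_pure db // pure0l add0r; apply: etrans (addr0 _) _.
  by apply: eq_bigr => i _; rewrite db // subr0 dp.
rewrite theta_pure db // pure0l add0r big1 // => i _.
rewrite db // subr0 (dG m) ?linear0 ?pure0l //.
by rewrite mem_cat mem_rem_uniq // inE ml mF0.
Qed.
End Basis.

Lemma submodule_contains_diff_tensor N t : submodule (lie_act T) N -> N t -> t != 0 ->
  forall w (p : P) (v : V), N (diff_tensor w p v).
Proof.
move=> sN Nt t0; have [b b_wt b_span] := wt_basis simP.
have [v v0 Nv] := submodule_has_diff_tensor b_wt b_span sN Nt t0.
exact: submodule_diff_tensor v0 Nv.
Qed.

(** For a weight vector p with d_i p nonzero, the d_j p have distinct weights l - e_j. Projecting to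
    weight l - e_i leaves d_i p (x) E_iw v = 0, which forces E_iw v = 0. *)
Lemma diff_tensor_eq0 : (forall w (p : P) (v : V), diff_tensor w p v = 0) ->
  forall i w v, E i w v = 0.
Proof.
move=> dt0 i w v; apply/eqP; apply: contrapT => /negP Ev0.
have [l [p [pl dp0]]] := der_neq0 i.
pose F := [seq l - delta_mx 0 j | j <- [seq j <- enum 'I_n | j != i]] : seq 'rV[K]_n.
have lF : l - delta_mx 0 i \notin F.
  apply/mapP => -[j]; rewrite mem_filter => /andP[ji _] /addrI /oppr_inj /rowP /(_ i) /eqP.
  by rewrite !mxE !eqxx [i == j]eq_sym (negbTE ji) oner_eq0.
have [e el eF] := weight_separation P lF.
have := pure_neq0 (wt_der i pl) dp0 Ev0; apply/negP; rewrite negbK.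
have e_dt : \sum_j pure (act e (act (dx j) p)) (E j w v) = 0.
  rewrite -[RHS](linear0 (tensor_op (act e) 1)) -[X in _ = _ X](dt0 w p v).
  by rewrite /diff_tensor [RHS]linear_sum; apply: eq_bigr => j _; apply/esym/tensor_opE.
apply/eqP; rewrite -[RHS]e_dt (bigD1 i) // big1 => [|j /andP[_ ji]].
  by apply/esym; apply: etrans (addr0 _) _; rewrite el //; apply: wt_der.
rewrite (eF (l - delta_mx 0 j)) ?pure0l //; last exact: wt_der.
by apply: map_f; rewrite mem_filter ji mem_enum.
Qed.

Lemma der_kernel_line p q : (forall j, act (dx j) p = 0) -> (forall j, act (dx j) q = 0) ->
  p != 0 -> exists c, q = c *: p.
Proof.
have wt0 r : (forall j, act (dx j) r = 0) -> wt 0 r.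
  by move=> r0 i; rewrite weyl_actM r0 linear0 mxE scale0r.
by move=> /wt0 p0 /wt0 q0 p_neq0; apply: wt_space_line p0 p_neq0 q0.
Qed.

Lemma trivial_gl_socle : (forall i w v, E i w v = 0) ->
  exists2 t0 : tensor P V, t0 != 0 &
    forall N t, submodule (lie_act T) N -> N t -> t != 0 -> N t0.
Proof.
move=> E0; have [v v0] := simple_module_neq0 simV.
have Vline u : exists c, u = c *: v.
  apply: (gl_simple_module_full (S := fun u => exists c, u = c *: v) simV _ _ _ _ v0).
  - by exists 0; rewrite scale0r.
  - by move=> a _ _ [c ->] [c' ->]; exists (a * c + c'); rewrite scalerDl scalerA.
  - by move=> a b x _; exists 0; rewrite E0 scale0r.
  by exists 1; rewrite scale1r.
have Tpure (t : tensor P V) : exists p, t = pure p v.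
  move: t; apply: tensor_ind => [p u|a _ _ [p ->] [q ->]|].
  - by have [c ->] := Vline u; exists (c *: p); rewrite pureZl pureZr.
  - by exists (a *: p + q); rewrite pure_linearl.
  by exists 0; rewrite pure0l.
(* With gl(n) acting by 0, [theta] sends p (x) v to d d_j p (x) v, and d d_j p ranges over P as d
   varies. *)
have Nfull N p j : submodule (lie_act T) N -> N (pure p v) -> act (dx j) p != 0 ->
    forall t, N t.
  move=> sN Np dp0 t; have [q ->] := Tpure t; have [d <-] := weyl_cyclic simP q dp0.
  have := submodule_theta d j sN Np; congr N.
  rewrite theta_pure big1 ?addr0 // => i _.
  by rewrite E0 pure0r.
have [l [p [pl p0]]] := weight_vector_exists.
(* If a nonzero [z] is killed by all d_j, then z (x) v lies in every nonzero submodule. If there is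
   none, every nonzero submodule is the whole space and any nonzero tensor will do. *)
have [[z [z0 dz]]|kerdx] := pselect (exists z, z != 0 /\ forall j, act (dx j) z = 0).
  have zwt : wt 0 z by move=> i; rewrite weyl_actM dz linear0 mxE scale0r.
  exists (pure z v) => [|N t sN Nt t0]; first exact: pure_neq0 zwt z0 v0.
  have [q tE] := Tpure t; rewrite tE in Nt t0.
  have [[j dq]|dq] := pselect (exists j, act (dx j) q != 0).
    exact: (Nfull N q j).
  have q0 : q != 0 by apply: contra_neq t0 => ->; rewrite pure0l.
  have [j|j|//|c ->] := der_kernel_line (p := q) (q := z).
  - by apply/eqP; apply: contrapT => /negP dqj; apply: dq; exists j.
  - exact: dz.
  by rewrite pureZl; apply: (submoduleZ c sN Nt).
exists (pure p v) => [|N t sN Nt t0]; first exact: pure_neq0 pl p0 v0.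
have [q tE] := Tpure t; rewrite tE in Nt t0.
have [[j dq]|dq] := pselect (exists j, act (dx j) q != 0).
  exact: (Nfull N q j).
case: kerdx; exists q; split; first by apply: contra_neq t0 => ->; rewrite pure0l.
by move=> j; apply/eqP; apply: contrapT => /negP dqj; apply: dq; exists j.
Qed.

Lemma tensor_module_unique_simple : exists! N, simple_submodule (lie_act T) N.
Proof.
have [[w [p [v dt0]]]|dt] := pselect (exists w (p : P) (v : V), diff_tensor w p v != 0).
  apply: unique_simple_submodule dt0 _ => N t sN Nt t0.
  exact: submodule_contains_diff_tensor t0 w p v.
have [|t0 t0_neq0 Nt0] := trivial_gl_socle; last exact: unique_simple_submodule t0_neq0 Nt0.
apply: diff_tensor_eq0 => w p v; apply/eqP; apply: contrapT => /negP dt0.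
by apply: dt; exists w, p, v.
Qed.
End TensorSocle.

Theorem proposition3p7 (R : realType) (n : nat)
    (P : weylModule R[i] n) (V : lieModule 'M[R[i]]_n) :
  simple_module (weyl_act P) -> weyl_weight_module P ->
  simple_module (lie_act V) -> gl_weight_module V ->
  exists! N : set (tensor_module P V),
    simple_submodule (lie_act (tensor_module P V)) N.
Proof. by move=> simP wtP simV _; apply: tensor_module_unique_simple. Qed.
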